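(* Let $f\in L^2(\mathbf R^d)$ have Hermite series expansion $f=\sum_{\alpha\in\mathbf N^d}c_\alpha(f)h_\alpha$. Then the following conditions are equivalent: (1) For every $r>0$ there exists $C>0$ such that $$|c_\alpha(f)|\le C\, r^{|\alpha|}(\alpha!)^{-\frac12}\quad\text{for all }\alpha\in\mathbf N^d.$$ (2) For every $r>0$ there exists $C>0$ such that $$\|H^Nf\|_{L^2}\le C\,2^N r^{\frac{N}{\log N}}\left(\frac{2N}{\log N}\right)^{N\left(1-\frac1{\log N}\right)}\quad\text{for all integers }N\ge 2.$$
   Context: $\mathbf N=\{0,1,2,\dots\}$. $(h_\alpha)_{\alpha\in\mathbf N^d}$ is the orthonormal basis of $L^2(\mathbf R^d)$ of (normalized) Hermite functions, and $c_\alpha(f)=(f,h_\alpha)_{L^2}$. $H=|x|^2-\Delta$ is the harmonic oscillator on $\mathbf R^d$, so that $Hh_\alpha=(2|\alpha|+d)h_\alpha$. For $f\in L^2(\mathbf R^d)$, $H^Nf$ is the Hermite expansion $\sum_\alpha(2|\alpha|+d)^Nc_\alpha(f)h_\alpha$, and $\|H^Nf\|_{L^2}=\big(\sum_\alpha(2|\alpha|+d)^{2N}|c_\alpha(f)|^2\big)^{1/2}\in[0,\infty]$. *)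

(* Defs.v *)
From HB Require Import structures.
From mathcomp Require Import all_boot all_order all_algebra.
From mathcomp Require Import all_classical all_reals all_analysis.
From mathcomp Require Import complex.

Set Implicit Arguments.
Unset Strict Implicit.
Unset Printing Implicit Defensive.

Import Order.TTheory GRing.Theory Num.Theory.
Import numFieldTopology.Exports numFieldNormedType.Exports.
Import ComplexField.

Local Open Scope classical_set_scope.
Local Open Scope ring_scope.
Local Open Scope complex_scope.

(* R^d with its Borel sigma-algebra, the one generated by the coordinates. *)
Notation Rvec R d := (d.-tuple (measurableTypeR R)).

Section lebesgue_vec.
Variable R : realType.

Definition vcons (n : nat) (p : measurableTypeR R * Rvec R n) : Rvec R n.+1 :=
  [tuple of p.1 :: p.2].

Definition vuncons (n : nat) (x : Rvec R n.+1) : measurableTypeR R * Rvec R n :=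
  (thead x, [tuple of behead x]).

Lemma vconsK n : cancel (@vcons n) (@vuncons n).
Proof. by move=> [a t]; rewrite /vuncons /vcons theadE; congr pair; exact/val_inj. Qed.

Lemma measurable_vcons n : measurable_fun [set: measurableTypeR R * Rvec R n] (@vcons n).
Proof. exact: measurable_cons. Qed.

Lemma measurable_vuncons n : measurable_fun [set: Rvec R n.+1] (@vuncons n).
Proof.
apply: measurable_fun_pair; last exact: measurable_behead.
exact: (measurable_tnth ord0).
Qed.

Section lebesgue_vecS.
Variables (n : nat) (mu : {sigma_finite_measure set (Rvec R n) -> \bar R}).

Definition lebesgue_vecS : set (Rvec R n.+1) -> \bar R :=
  pushforward ((@lebesgue_measure R) \x mu)%E (@vcons n).

HB.instance Definition _ := Measure.copy lebesgue_vecS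
  (measure_function_pushforward__canonical__measure_function_Measure
     ((@lebesgue_measure R) \x mu)%E (@measurable_vcons n)).

Lemma lebesgue_vecS_sigma_finite : sigma_finite setT lebesgue_vecS.
Proof.
have /sigma_finiteP[F [TF ndF Foo]] := sigma_finiteT (@lebesgue_measure R).
have /sigma_finiteP[G [TG ndG Goo]] := sigma_finiteT mu.
exists (fun k => @vuncons n @^-1` (F k `*` G k)).
  rewrite -preimage_bigcup -[LHS](preimage_setT (@vuncons n)); congr (_ @^-1` _).
  rewrite -setXTT TF TG predeqE => -[x y]; split.
    move=> [/= [k _ Fkx] [l _ Gly]]; exists (maxn k l) => //; split.
    - by move: x Fkx; exact/subsetPset/ndF/leq_maxl.
    - by move: y Gly; exact/subsetPset/ndG/leq_maxr.
  by move=> [k _ []/= ? ?]; split; exists k.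
move=> k; have [mF Fk] := Foo k; have [mG Gk] := Goo k; split.
  by rewrite -[X in measurable X]setTI; apply: measurable_vuncons => //; exact: measurableX.
rewrite /lebesgue_vecS /pushforward -comp_preimage.
rewrite (_ : @vuncons n \o _ = id); last by apply/funext => p; exact: vconsK.
by rewrite preimage_id product_measure1E// lte_mul_pinfty// ge0_fin_numE.
Qed.

HB.instance Definition _ := @Measure_isSigmaFinite.Build _ _ _ lebesgue_vecS
  lebesgue_vecS_sigma_finite.

End lebesgue_vecS.

Fixpoint lebesgue_vec (d : nat) : {sigma_finite_measure set (Rvec R d) -> \bar R} :=
  match d with
  | 0 => \d_ [tuple]
  | n.+1 => lebesgue_vecS (lebesgue_vec n)
  end.

Lemma lebesgue_vec_box (d : nat) (A : 'I_d -> set (measurableTypeR R)) :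
  (forall i, measurable (A i)) ->
  lebesgue_vec d [set x | forall i, A i (tnth x i)] =
  (\prod_i lebesgue_measure (A i))%E.
Proof.
elim: d A => [A _|n IH A mA].
  rewrite big_ord0 /= diracE mem_set// => -[]//.
rewrite big_ord_recl -IH; last by move=> i; exact: mA.
rewrite /= /lebesgue_vecS /pushforward.
rewrite (_ : _ @^-1` _ = A ord0 `*` [set x | forall i, A (lift ord0 i) (tnth x i)]).
  rewrite product_measure1E//.
  rewrite (_ : [set _ | _] = \bigcap_(i in [set: 'I_n]) ((fun x : Rvec R n => tnth x i) @^-1` (A (lift ord0 i)))).
    apply: fin_bigcap_measurable => //= i _; rewrite -[X in measurable X]setTI. exact: measurable_tnth.
  by apply/seteqP; split=> x /= h i; [move=> _; exact: h|exact: (h i I)].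
apply/seteqP; split=> -[a t] /= h.
  split; first by have := h ord0.
  move=> i. have := h (lift ord0 i). by rewrite tnthS.
move=> i; case: (unliftP ord0 i) => [j ->|->]; rewrite ?tnthS; by case: h.
Qed.

End lebesgue_vec.

Section hermite.
Variable R : realType.

(* Rodrigues' formula, normalized in L^2(R); the eigenfunction of x^2 - d^2/dx^2
   with eigenvalue 2n + 1. *)
Definition hermite1 (n : nat) (x : R) : R :=
  (-1) ^+ n * (2 ^+ n * n`!%:R * Num.sqrt pi) `^ (- 2^-1) *
  expR (x ^+ 2 / 2) * derive1n n (fun t : R => expR (- t ^+ 2)) x.

Variable d : nat.

Definition multiindex := {ffun 'I_d -> nat}.

Definition mabs (alpha : multiindex) : nat := (\sum_i alpha i)%N.

Definition mfact (alpha : multiindex) : nat := (\prod_i (alpha i)`!)%N.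

Definition hermite (alpha : multiindex) (x : Rvec R d) : R :=
  \prod_i hermite1 (alpha i) (tnth x i).

(* L^2 functions are represented by everywhere defined Borel functions. *)
Definition in_L2 (f : Rvec R d -> R[i]) : Prop :=
  [/\ measurable_fun setT (fun x => complex.Re (f x) : measurableTypeR R),
      measurable_fun setT (fun x => complex.Im (f x) : measurableTypeR R) &
      (\int[lebesgue_vec R d]_x (Normc.normc (f x) ^+ 2)%:E < +oo)%E].

Definition cintegral (g : Rvec R d -> R[i]) : R[i] :=
  \int[lebesgue_vec R d]_x complex.Re (g x) +i*
  \int[lebesgue_vec R d]_x complex.Im (g x).

Definition inner_L2 (f g : Rvec R d -> R[i]) : R[i] :=
  cintegral (fun x => f x * (g x)^*).

Definition hermite_coef (f : Rvec R d -> R[i]) (alpha : multiindex) : R[i] :=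
  inner_L2 f (fun x => (hermite alpha x)%:C).

(* The formal Hermite series H^N f, given by its coefficients. *)
Definition harmonic_pow (N : nat) (f : Rvec R d -> R[i])
    (alpha : multiindex) : R[i] :=
  (2 * mabs alpha + d)%N%:R ^+ N * hermite_coef f alpha.

(* The L^2 norm of the Hermite series with coefficients a, by Parseval. *)
Definition hermite_series_norm (a : multiindex -> R[i]) : \bar R :=
  ((\esum_(alpha in [set: multiindex]) (Normc.normc (a alpha) ^+ 2)%:E)
     `^ 2^-1)%E.

End hermite.

(* Main.v *)
(* Only the moduli [a alpha = |c_alpha(f)|] matter.  Put [n = |alpha|],
   [L = ln N], [M = N / L], so that the bound in (2) is
   [C 2^N r^M (2 M)^(N - M)].

   (2) => (1).  A single coefficient satisfies
   [n^N a alpha <= C r^M (2 M)^(N - M)].  Let [N] be the largest integer with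
   [2 M <= n].  Then [n / 2 - 1 <= M <= n / 2], and the right-hand side is at
   most [C n^N (r / n)^M], so that [a alpha] is of order
   [(n / r) r^(n/2) n^(-n/2)]; conclude with [alpha! <= n! <= n^n].

   (1) => (2).  Up to factors exponential in [n], [alpha!] is at least [m!] with
   [m = n + d + 1], so it suffices to bound [m^N s^m / sqrt m!] uniformly in
   [m], for some small [s].  By Stirling, this is a comparison of
   exponents, homogeneous in [x = m / (2 M)].  Choosing [s] smaller by a factor
   exponential in [m] leaves a factor [2^-n], which makes the sum over [alpha]
   converge. *)
Require Import Defs.
From mathcomp Require Import all_boot all_order all_algebra.
From mathcomp Require Import all_classical all_reals all_analysis.
From mathcomp Require Import complex.
From mathcomp Require Import finmap zify ring lra.
Import Order.TTheory GRing.Theory Num.Theory.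
Import numFieldTopology.Exports numFieldNormedType.Exports.

Local Open Scope ring_scope.

(** * Factorials of sums against products of factorials *)

Lemma leq_fact2_factD (m n : nat) : (m`! * n`! <= (m + n)`!)%N.
Proof. by rewrite -(bin_fact (leq_addr n m)) addKn leq_pmull ?bin_gt0 ?leq_addr. Qed.

(** A binomial coefficient is one term of the expansion of [(1 + 1)^(m + n)]. *)
Lemma leq_factD (m n : nat) : ((m + n)`! <= 2 ^ (m + n) * (m`! * n`!))%N.
Proof.
rewrite -(bin_fact (leq_addr n m)) addKn leq_mul2r; apply/orP; right.
rewrite -[2%N]/(1 + 1)%N expnDn.
by rewrite (bigD1 (Ordinal (leq_addr n m : m < (m + n).+1)%N)) //= !exp1n !muln1 leq_addr.
Qed.

Lemma leq_fact_expn n : (n`! <= n ^ n)%N.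
Proof.
elim: n => // n IH; rewrite factS expnS leq_mul2l /=.
apply: leq_trans IH _; case: n => // n; by rewrite leq_exp2r.
Qed.

Lemma leq_prod_fact (I : Type) (s : seq I) (a : I -> nat) :
  (\prod_(i <- s) (a i)`! <= (\sum_(i <- s) a i)`!)%N.
Proof.
elim: s => [|i s IH]; first by rewrite !big_nil.
by rewrite !big_cons (leq_trans _ (leq_fact2_factD _ _)) // leq_mul2l IH orbT.
Qed.

(** Splitting off one summand at a time costs a power of 2 at each step; [k] is left for a shift of
    the total degree. *)
Lemma leq_fact_sum (I : Type) (s : seq I) (a : I -> nat) (k : nat) :
  ((\sum_(i <- s) a i + k)`! <=
    k`! * (2 ^ (size s * (\sum_(i <- s) a i + k)) * \prod_(i <- s) (a i)`!))%N.
Proof.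
elim: s => [|i s IH]; first by rewrite !big_nil muln1 muln1.
rewrite !big_cons -addnA (leq_trans (leq_factD _ _)) // /= mulSn [(2 ^ (_ + size s * _))%N]expnD.
set S := (\sum_(j <- s) _ + k)%N in IH *.
have h : (2 ^ (size s * S) <= 2 ^ (size s * (a i + S)))%N.
  by rewrite leq_exp2l // leq_mul2l leq_addl orbT.
move: IH h; set P := \prod_(j <- s) _; set X := (2 ^ (size s * S))%N.
set Y := (2 ^ (size s * _))%N => IH h.
have {IH}IH : (S`! <= k`! * (Y * P))%N.
  by rewrite (leq_trans IH) // leq_mul2l leq_mul2r h !orbT.
rewrite (_ : (k`! * _ = 2 ^ (a i + S) * ((a i)`! * (k`! * (Y * P))))%N).
  by rewrite !leq_mul2l IH !orbT.
clear IH h; move: (k`!) (2 ^ (a i + S))%N ((a i)`!) Y P => *; lia.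
Qed.

(** * Logarithm estimates and the comparison of exponents *)

Section real_estimates.
Variable R : realType.
Implicit Types x y r s L M : R.

(** By concavity, [ln] lies below its tangent at [y]. *)
Lemma ln_le_tangent x y : 0 < x -> 0 < y -> ln x <= ln y + (x - y) / y.
Proof.
move=> x0 y0; have xy : -1 < (x - y) / y.
  by rewrite mulrBl divff ?gt_eqF // ltrBDr addrC subrr divr_gt0.
have := le_ln1Dx xy; rewrite (_ : 1 + _ = x / y); last by field; rewrite gt_eqF.
by rewrite ln_div ?posrE // lerBlDl.
Qed.

Lemma ln_le_sqrt x : 0 < x -> ln x <= 2 * Num.sqrt x.
Proof.
move=> x0; have s0 : 0 < Num.sqrt x by rewrite sqrtr_gt0.
rewrite -{1}(sqr_sqrtr (ltW x0)) lnXn // -[leLHS]mulr_natl ler_pM2l //.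
exact/ltW/ln_sublinear.
Qed.

Lemma ln2_ge_half : 2^-1 <= ln 2 :> R.
Proof. have := @ln_le_tangent 1 2 ltr01 ltac:(by []); rewrite ln1; lra. Qed.

Lemma ln_nat_gt0 (N : nat) : (2 <= N)%N -> 0 < ln N%:R :> R.
Proof. by move=> N2; rewrite ln_gt0 // ltr1n. Qed.

(* The exponent comparison behind (1) => (2), divided by [M]; here [r] and [s]
   stand for the logarithms of the bases.  The part linear in [L],
   [L (ln x - x + 1)], is nonpositive and vanishes only at [x = 1]. *)
Lemma exponent_le L x r s : 2 <= L -> 0 < x -> 4 * (1 - r) <= L ->
  s <= 0 -> 5 + s / 2 <= r ->
  L * ln x - (L - ln (L / 2)) * (x - 1) - x * ln x + 2 * x * s <= r.
Proof.
move=> L2 x0 Lr s0 sr; set l := ln (L / 2).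
have L0 : 0 < L by lra.
have l0 : 0 <= l by rewrite ln_ge0 // ler_pdivlMr // mul1r.
have lL : l <= L / 2 by apply/ltW/ln_sublinear; lra.
have l2 : l ^+ 2 <= 2 * L.
  have sq0 := sqrtr_ge0 (L / 2).
  have := @ln_le_sqrt (L / 2) ltac:(lra); rewrite -/l => lsq.
  have := @sqr_sqrtr _ (L / 2) ltac:(lra).
  nra.
have xln : - (x * ln x) <= 1 - x.
  have := @ln_le_tangent 1 x ltr01 x0; rewrite ln1 => h.
  have : 0 * x <= (ln x + (1 - x) / x) * x by rewrite ler_pM2r.
  rewrite mul0r mulrDl divfK ?gt_eqF //; lra.
have [x14|x14] := leP 4^-1 x.
  have Ll : 0 < L - l by lra.
  (* [y] maximizes [L ln x - (L - l) (x - 1)]; the maximum is at most [l^2 / (L - l) <= 4], by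
     [l^2 <= 2 L] and [l <= L / 2]. *)
  set y := L / (L - l); have y0 : 0 < y by rewrite divr_gt0.
  have key : L * ln x - (L - l) * (x - 1) <= 4.
    have h1 : L * ln x <= L * ln y + (L - l) * (x - y).
      have := ln_le_tangent x y x0 y0; rewrite -(ler_pM2l L0) => /le_trans; apply.
      rewrite mulrDr lerD2l /y le_eqVlt; apply/orP; left; apply/eqP; field.
      by rewrite !gt_eqF.
    have h2 : L * ln y <= L * (y - 1).
      by rewrite ler_pM2l //; have := ln_le_tangent y 1 y0 ltr01; rewrite ln1 divr1 add0r.
    have h3 : (L - l) * y = L by rewrite /y mulrCA divff ?mulr1 // gt_eqF.
    have h4 : L * y - L - l <= 4.
      rewrite -(ler_pM2r Ll) (_ : (L * y - L - l) * (L - l) = l ^+ 2).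
        nra.
      by rewrite /y; field; rewrite gt_eqF.
    lra.
  (* Since [x >= 1/4] and [s <= 0], [2 x s <= s / 2]; the total is at most [4 + 1 + s / 2]. *)
  nra.
(* For [x < 1/4] the linear part is at most [- L / 4], by the tangent at [1/4]; the other terms add
   at most 1, and [4 (1 - r) <= L] concludes. *)
have h : L * (ln x - x + 1) <= L * (- 4^-1).
  rewrite ler_pM2l //; have := @ln_le_tangent x (2 ^+ 2)^-1 x0 ltac:(by rewrite invr_gt0 exprn_gt0).
  rewrite lnV ?posrE ?exprn_gt0 // lnXn //; have := ln2_ge_half.
  rewrite invrK; lra.
nra.
Qed.

(** The bound of (2) stripped of the factor [C 2^N]. *)
Definition weight r (N : nat) : R :=
  r `^ (N%:R / ln N%:R) *
  (2 * N%:R / ln N%:R) `^ (N%:R * (1 - (ln N%:R)^-1)).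

Lemma weight_gt0 r (N : nat) : 0 < r -> (2 <= N)%N -> 0 < weight r N.
Proof.
move=> r0 N2; rewrite mulr_gt0 ?powR_gt0 // divr_gt0 ?ln_nat_gt0 //.
by rewrite mulr_gt0 // ltr0n; case: N N2.
Qed.

Lemma weightE r (N : nat) : 0 < r -> (2 <= N)%N ->
  weight r N = expR (N%:R / ln N%:R *
    (ln r + (ln N%:R - 1) * ln (2 * N%:R / ln N%:R))).
Proof.
move=> r0 N2; have L0 := ln_nat_gt0 _ N2.
have x0 : 0 < 2 * N%:R / ln N%:R :> R.
  by rewrite divr_gt0 // mulr_gt0 // ltr0n; case: N N2 {L0}.
rewrite -[LHS]lnK ?posrE ?weight_gt0 // /weight lnM ?posrE ?powR_gt0 //.
by rewrite !ln_powR; congr expR; field; rewrite gt_eqF.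
Qed.

(** * Bounding [m^N s^m / sqrt m!] by the weight *)

Lemma expn_le_fact_expR (k n : nat) : n%:R ^+ k <= k`!%:R * expR n%:R :> R.
Proof.
case: k => [|k]; first by rewrite expr0 fact0 mul1r; have := expR_ge1Dx (n%:R : R);
  have := ler0n R n; lra.
rewrite -ler_pdivrMl ?ltr0n ?fact_gt0 // mulrC.
have := @expR_ge1Dxn R n%:R k (ler0n _ _); lra.
Qed.

(** The lower Stirling bound [n! >= (n / e)^n], which is the preceding estimate at [k = n]. *)
Lemma inv_sqrt_fact_le (n : nat) : (0 < n)%N ->
  (Num.sqrt n`!%:R)^-1 <= expR (n%:R / 2 * (1 - ln n%:R)) :> R.
Proof.
move=> n0; have f0 : 0 < n`!%:R :> R by rewrite ltr0n fact_gt0.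
rewrite -[leLHS]lnK ?posrE ?invr_gt0 ?sqrtr_gt0 // ler_expR.
rewrite lnV ?posrE ?sqrtr_gt0 // -powR12_sqrt ?(ltW f0) // ln_powR.
have nR : 0 < n%:R :> R by rewrite ltr0n.
have : ln (n%:R ^+ n) <= ln (n`!%:R * expR n%:R) :> R.
  by rewrite ler_ln ?posrE ?mulr_gt0 ?expR_gt0 ?exprn_gt0 ?expn_le_fact_expR.
rewrite lnXn // lnM ?posrE ?expR_gt0 // expRK -[leLHS]mulr_natl. lra.
Qed.

Lemma monomial_le_weight_large r s (m N : nat) : 0 < r -> 0 < s -> (0 < m)%N ->
  (2 <= N)%N -> 2 <= ln N%:R :> R -> 4 * (1 - ln r) <= ln N%:R ->
  ln s <= - 1 -> 6 + ln s / 2 <= ln r ->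
  m%:R ^+ N * s ^+ m / Num.sqrt m`!%:R <= weight r N.
Proof.
move=> r0 s0 m0 N2 L2 Lr s1 sr.
have mR : 0 < m%:R :> R by rewrite ltr0n.
have NR : 0 < N%:R :> R by rewrite ltr0n; case: N N2 {L2 Lr}.
have L0 := ln_nat_gt0 _ N2; rewrite weightE //.
rewrite -[m%:R ^+ N]lnK ?posrE ?exprn_gt0 // -[s ^+ m]lnK ?posrE ?exprn_gt0 //.
rewrite -expRD; apply: le_trans (ler_wpM2l (expR_ge0 _) (inv_sqrt_fact_le _ m0)) _.
rewrite -expRD ler_expR !lnXn // -[ln m%:R *+ N]mulr_natl -[ln s *+ m]mulr_natl.
set L := ln N%:R in L0 L2 Lr *; set M : R := N%:R / L.
have M0 : 0 < M by rewrite divr_gt0.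
have NE : N%:R = M * L by rewrite /M divfK ?gt_eqF.
have tE : ln (2 * N%:R / L) = L - ln (L / 2).
  rewrite (_ : 2 * N%:R / L = N%:R / (L / 2)); last by field; rewrite gt_eqF.
  by rewrite [LHS]ln_div ?posrE // divr_gt0.
set x := m%:R / (2 * M); have x0 : 0 < x by rewrite divr_gt0 // mulr_gt0.
have mE : m%:R = 2 * M * x by rewrite /x mulrC divfK // gt_eqF // mulr_gt0.
have lmE : ln m%:R = ln x + (L - ln (L / 2)).
  rewrite -tE -lnM ?posrE //; last by rewrite divr_gt0 // mulr_gt0.
  by rewrite {1}mE /M; congr ln; ring.
(* The shift [2^-1] accounts for the factor [e^(m/2)] of the Stirling bound. *)
have h := @exponent_le L x (ln r) (ln s + 2^-1) L2 x0 Lr ltac:(lra) ltac:(lra).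
have := ler_wpM2l (ltW M0) h; rewrite tE lmE mE NE; lra.
Qed.

(** Large [N] are covered with constant 1. For the finitely many others,
    [m^N s^m <= N! e^m e^-m = N!], so the sum of [N! / weight r N] is added to the constant. *)
Lemma monomial_le_weight r : 0 < r -> exists2 s : R, 0 < s & exists2 C : R, 0 < C &
  forall m N : nat, (0 < m)%N -> (2 <= N)%N ->
  m%:R ^+ N * s ^+ m / Num.sqrt m`!%:R <= C * weight r N.
Proof.
(* With [ln s = a], [6 + a / 2 = - 1 - |ln r| <= ln r], and [a <= -1] also gives [s^m <= e^-m]. *)
move=> r0; set a := - (14 + 2 * `|ln r|).
have na := normr_ge0 (ln r); have la := ler_norm (- ln r); rewrite normrN in la.
exists (expR a); first exact: expR_gt0.
(* Beyond [N0], [ln N] exceeds both thresholds [2] and [4 (1 - ln r)]. *)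
set N0 := (Num.truncn (expR (2 + 4 * (1 + `|ln r|)))).+1.
have S0 : 0 <= \sum_(2 <= N < N0) N`!%:R / weight r N.
  rewrite big_nat; apply: sumr_ge0 => N /andP[N2 _].
  by rewrite divr_ge0 // ltW // weight_gt0.
exists (1 + \sum_(2 <= N < N0) N`!%:R / weight r N); first lra.
move=> m N m0 N2; have w0 := weight_gt0 _ _ r0 N2.
have [NN0|NN0] := leqP N0 N.
  apply: (@le_trans _ _ (weight r N)); last by rewrite ler_peMl ?(ltW w0) // lerDl.
  have lN : 2 + 4 * (1 + `|ln r|) <= ln N%:R.
    rewrite -ler_expR lnK ?posrE ?ltr0n ?(leq_trans _ N2) //.
    by rewrite (le_trans (ltW (truncnS_gt _))) // ler_nat.
  by apply: monomial_le_weight_large; rewrite ?expR_gt0 ?expRK // /a; lra.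
apply: (@le_trans _ _ N`!%:R).
  rewrite -[leRHS]mulr1; apply: ler_pM.
  - by rewrite mulr_ge0 ?exprn_ge0 ?expR_ge0.
  - by rewrite invr_ge0 sqrtr_ge0.
  - have h : expR a ^+ m <= (expR m%:R)^-1.
      rewrite -expRM_natl -expRN ler_expR -[leRHS]mulrN1 ler_wpM2l // /a; lra.
    rewrite -[leRHS](@mulfK _ (expR m%:R)) ?expR_eq0 //.
    by apply: ler_pM; rewrite ?exprn_ge0 ?expR_ge0 ?expn_le_fact_expR.
  - rewrite invf_le1 ?sqrtr_gt0 ?ltr0n ?fact_gt0 //.
    by rewrite -[leLHS]sqrtr1 ler_wsqrtr // ler1n fact_gt0.
rewrite -ler_pdivrMr // ler_wpDl // (bigD1_seq N) ?mem_index_iota ?N2 ?iota_uniq //=.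
rewrite lerDl big_seq_cond; apply: sumr_ge0 => i /andP[]; rewrite mem_index_iota.
by case/andP => i2 _ _; rewrite divr_ge0 // ltW // weight_gt0.
Qed.

(** * The choice of [N] adapted to a given degree [n] *)

Lemma exists_weight_le r (n : nat) : 0 < r -> r <= 1 -> (8 <= n)%N ->
  exists2 N : nat, (4 <= N)%N &
    weight r N <= n%:R ^+ N * (n%:R / r) * expR (n%:R / 2 * (ln r - ln n%:R)).
Proof.
move=> r0 r1 n8; have nR : 0 < n%:R :> R by rewrite ltr0n (leq_trans _ n8).
(* Requiring [4 <= N] ensures [ln N >= 1]; [n >= 8] makes [N = 4] admissible. *)
pose P (N : nat) := (4 <= N)%N && (2 * N%:R / ln N%:R <= n%:R :> R).
have l4 : 1 <= ln 4%:R :> R.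
  by rewrite (natrX _ 2 2) lnXn //; have := ln2_ge_half; lra.
have P4 : P 4%N.
  rewrite /P /= ler_pdivrMr ?ln_nat_gt0 //.
  have : 8%:R <= n%:R :> R by rewrite ler_nat.
  nra.
(* From [2 N <= n ln N <= 2 n sqrt N], a largest admissible [N] exists. *)
have ubP N : P N -> (N <= n ^ 2)%N.
  case/andP => N4; have N0 : 0 < N%:R :> R by rewrite ltr0n (leq_trans _ N4).
  have L0 := ln_nat_gt0 N (leq_trans (isT : 2 <= 4)%N N4).
  rewrite ler_pdivrMr // -(ler_nat R) natrX => h.
  have sq := sqr_sqrtr (ltW N0); have s0 : 0 < Num.sqrt N%:R :> R by rewrite sqrtr_gt0.
  have h2 := ler_wpM2l (ltW nR) (ln_le_sqrt _ N0).
  have h3 : Num.sqrt N%:R <= n%:R :> R.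
    rewrite -(ler_pM2r s0) -expr2 sq; lra.
  by rewrite -sq ler_pXn2r // nnegrE ltW.
case: (ex_maxnP (ex_intro (fun N => P N) _ P4) ubP) => N /andP[N4 Nn] Nmax.
exists N => //; have N2 : (2 <= N)%N by exact: leq_trans N4.
have N0 : 0 < N%:R :> R by rewrite ltr0n (leq_trans _ N4).
have L1 : 1 <= ln N%:R :> R.
  by rewrite (le_trans l4) // ler_ln ?posrE // ler_nat.
have SN : n%:R < 2 * N.+1%:R / ln N%:R :> R.
  have : ~~ P N.+1 by apply/negP => /Nmax; rewrite ltnn.
  rewrite /P (leq_trans N4) //= -ltNge => /lt_le_trans; apply.
  rewrite ler_wpM2l ?mulr_ge0 // lef_pV2 ?posrE ?ln_nat_gt0 //; last by lia.
  by rewrite ler_ln ?posrE // ler_nat.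
rewrite weightE // -[n%:R ^+ N]lnK ?posrE ?exprn_gt0 //.
rewrite -[n%:R / r]lnK ?posrE ?divr_gt0 // -!expRD ler_expR lnXn // [ln (_ / r)]ln_div ?posrE //.
rewrite -[ln n%:R *+ N]mulr_natl; move: Nn SN.
have q0 : ln r <= 0 by rewrite ln_le0.
have p0 : 0 <= ln n%:R :> R by rewrite ln_ge0 // ler1n (leq_trans _ n8).
set L := ln N%:R in L1 *; set M := N%:R / L => Nn SN.
have L0 : 0 < L by lra.
have M0 : 0 < M by rewrite divr_gt0.
have tn : ln (2 * N%:R / L) <= ln n%:R by rewrite ler_ln ?posrE // divr_gt0 // mulr_gt0.
(* Maximality gives [n < 2 (N + 1) / ln N <= 2 M + 2]; the lost 1 produces the extra factor
   [n / r]. *)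
have Mn : n%:R / 2 - 1 <= M.
  have : 2 * N.+1%:R / L <= 2 * M + 2.
    rewrite -[N.+1%:R]natr1 mulrDr mulrDl mulr1 -mulrA -/M lerD2l ler_pdivrMr //; lra.
  lra.
have -> : N%:R * ln n%:R = M * L * ln n%:R by rewrite /M divfK ?gt_eqF.
have h1 : M * ((L - 1) * ln (2 * N%:R / L)) <= M * ((L - 1) * ln n%:R).
  by rewrite ler_pM2l // ler_wpM2l // subr_ge0.
have pq : 0 <= ln n%:R - ln r by lra.
have h2 := ler_wpM2r pq Mn.
lra.
Qed.
End real_estimates.

Arguments weight {R}.

(** * Summation over multi-indices and the norm of a Hermite series *)

Lemma sum_half_mabs_le (R : realType) (d : nat) (F : {fset multiindex d}) :
  \sum_(alpha <- F) 2^-1 ^+ mabs alpha <= 2 ^+ d :> R.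
Proof.
(* All entries of indices in [F] are below [K], so [F] lies in a cube over which the sum factors
   into [d] geometric sums, each at most 2. *)
pose K := (\max_(alpha <- F) mabs alpha).+1.
have FK (alpha : multiindex d) : alpha \in F -> forall i, (alpha i < K)%N.
  move=> aF i; rewrite ltnS.
  apply: (@leq_trans (mabs alpha)); first by rewrite /mabs (bigD1 i) //= leq_addr.
  by apply: leq_bigmax_seq.
pose emb (g : {ffun 'I_d -> 'I_K}) : multiindex d := [ffun i => g i : nat].
have emb_inj : injective emb.
  move=> g h /ffunP gh; apply/ffunP => j; apply: val_inj.
  by have := gh j; rewrite !ffunE.
have -> : 2 ^+ d = \prod_(i < d) (2 : R) by rewrite prodr_const card_ord.
apply: (@le_trans _ _ (\prod_(i < d) \sum_(k < K) (2^-1 : R) ^+ k)); last first.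
  apply: ler_prod => i _; rewrite sumr_ge0 /=; last by move=> k _; exact: exprn_ge0.
  have := subrX1 (2^-1 : R) K; have : 0 <= (2^-1 : R) ^+ K by exact: exprn_ge0.
  lra.
rewrite bigA_distr_bigA /=.
have -> : \sum_(g : {ffun 'I_d -> 'I_K}) \prod_i (2^-1 : R) ^+ g i =
    \sum_(alpha <- [seq emb g | g <- index_enum {ffun 'I_d -> 'I_K}])
      2^-1 ^+ mabs alpha.
  rewrite big_map; apply: eq_bigr => g _; rewrite prodrXr; congr (_ ^+ _).
  by apply: eq_bigr => i _; rewrite ffunE.
rewrite [leRHS](bigID (mem F)) /= -[X in _ <= X + _]big_filter.
rewrite [X in _ <= X + _](perm_big F) /=; last first.
  apply: uniq_perm; first by rewrite filter_uniq // map_inj_uniq // index_enum_uniq.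
    exact: fset_uniq.
  move=> alpha; rewrite mem_filter; apply: andb_idr => aF.
  apply/mapP; exists [ffun i => Ordinal (FK alpha aF i)]; first exact: mem_index_enum.
  by apply/ffunP => i; rewrite !ffunE.
by rewrite lerDl sumr_ge0 // => alpha _; exact: exprn_ge0.
Qed.

Lemma normc_ge0 (R : rcfType) (z : R[i]) : 0 <= Normc.normc z.
Proof. by case: z => x y; exact: sqrtr_ge0. Qed.

Section hermite_series_norm.
Variables (R : realType) (d : nat).
Implicit Types (a : multiindex d -> R[i]) (alpha : multiindex d).

Lemma normc_le_hermite_series_norm a alpha :
  ((Normc.normc (a alpha))%:E <= hermite_series_norm a)%E.
Proof.
have n0 := normc_ge0 R (a alpha).
have -> : (Normc.normc (a alpha))%:E =
    (((Normc.normc (a alpha) ^+ 2)%:E) `^ 2^-1)%E.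
  by rewrite poweR_EFin powR12_sqrt ?exprn_ge0 // sqrtr_sqr ger0_norm.
apply: gt0_ler_poweR => //.
- by rewrite in_itv /= leey lee_fin exprn_ge0.
- by rewrite in_itv /= leey andbT esum_ge0 // => i _; rewrite lee_fin exprn_ge0 // normc_ge0.
apply: esum_ge; exists [set alpha]%classic; first by split.
by rewrite fsbig_set1.
Qed.

(** The squares [4^-|alpha|] are bounded by [2^-|alpha|], whose sum is at most [2^d]. *)
Lemma hermite_series_norm_le a (K : R) : 0 <= K ->
  (forall alpha, Normc.normc (a alpha) <= K * 2^-1 ^+ mabs alpha) ->
  (hermite_series_norm a <= (K * Num.sqrt (2 ^+ d))%:E)%E.
Proof.
move=> K0 aK.
have n0 alpha := normc_ge0 R (a alpha).
have -> : (K * Num.sqrt (2 ^+ d))%:E = (((K ^+ 2 * 2 ^+ d)%:E) `^ 2^-1)%E.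
  rewrite poweR_EFin powR12_sqrt ?mulr_ge0 ?exprn_ge0 //.
  by rewrite sqrtrM ?exprn_ge0 // sqrtr_sqr ger0_norm.
apply: gt0_ler_poweR => //.
- by rewrite in_itv /= leey andbT esum_ge0 // => i _; rewrite lee_fin exprn_ge0.
- by rewrite in_itv /= leey lee_fin mulr_ge0 ?exprn_ge0.
apply: ge_ereal_sup => _ [X [finX _] <-].
rewrite fsbig_finite //= sumEFin lee_fin.
apply: le_trans (ler_wpM2l (sqr_ge0 K) (sum_half_mabs_le _ _ (fset_set X))).
rewrite mulr_sumr; apply: ler_sum => alpha _.
rewrite (le_trans (y := (K * 2^-1 ^+ mabs alpha) ^+ 2)) //.
  by rewrite ler_sqr ?nnegrE ?mulr_ge0 ?exprn_ge0.
rewrite exprMn ler_wpM2l ?sqr_ge0 // expr2 ler_piMr ?exprn_ge0 //.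
by apply: exprn_ile1 => //; lra.
Qed.
End hermite_series_norm.

(** * Moduli of the coefficients and multi-index factorials *)

Lemma normc_natXM (R : rcfType) (k n : nat) (z : R[i]) :
  Normc.normc (k%:R ^+ n * z) = k%:R ^+ n * Normc.normc z.
Proof.
elim: n => [|n IH]; first by rewrite !mul1r.
rewrite !exprS -!mulrA Normc.normcM IH; congr (_ * _).
by rewrite -(rmorph_nat (real_complex R)) /= expr0n /= addr0 sqrtr_sqr ger0_norm.
Qed.

Lemma powRN_half (R : realType) (x : R) : 0 <= x -> x `^ (- 2^-1) = (Num.sqrt x)^-1.
Proof. by move=> x0; rewrite powRN powR12_sqrt. Qed.

Lemma mfact_gt0 (d : nat) (alpha : multiindex d) : (0 < mfact alpha)%N.
Proof. by rewrite prodn_gt0 // => i; exact: fact_gt0. Qed.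

Lemma leq_mfact (d : nat) (alpha : multiindex d) : (mfact alpha <= (mabs alpha)`!)%N.
Proof. exact: leq_prod_fact. Qed.

Lemma leq_mabs_fact (d : nat) (alpha : multiindex d) (k : nat) :
  ((mabs alpha + k)`! <= k`! * (2 ^ (d * (mabs alpha + k)) * mfact alpha))%N.
Proof.
have := @leq_fact_sum _ (index_enum 'I_d) alpha k.
by rewrite -[size _]sum1_size big_const_ord iter_addn_0 mul1n.
Qed.

(** Trades [alpha!] for [m!] at exponential cost; the root of [2^(d m)] is coarsened to [2^(d m)]
    itself. *)
Lemma inv_sqrt_mfact_le (R : realType) (d : nat) (alpha : multiindex d) (k : nat) :
  (Num.sqrt (mfact alpha)%:R)^-1 <=
    Num.sqrt k`!%:R * 2 ^+ (d * (mabs alpha + k)) /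
    Num.sqrt (mabs alpha + k)`!%:R :> R.
Proof.
set m := (mabs alpha + k)%N; have g0 : 0 < Num.sqrt (mfact alpha)%:R :> R.
  by rewrite sqrtr_gt0 ltr0n mfact_gt0.
rewrite ler_pdivlMr ?sqrtr_gt0 ?ltr0n ?fact_gt0 // mulrC ler_pdivrMr //.
rewrite -[2 ^+ _]ger0_norm ?exprn_ge0 // -sqrtr_sqr -!sqrtrM ?mulr_ge0 ?exprn_ge0 //.
rewrite ler_wsqrtr // -!natrX -!natrM ler_nat.
apply: leq_trans (leq_mabs_fact _ alpha k) _; rewrite -mulnA -/m.
by rewrite leq_mul2l leq_mul2r -mulnn leq_pmull ?expn_gt0 ?orbT.
Qed.

(** * Equivalence of coefficient decay and growth of [H^N f] *)

Theorem theorem2 (R : realType) (d : nat) (f : Rvec R d -> R[i]) (hf : in_L2 f) :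
  (forall r : R, 0 < r -> exists2 C : R, 0 < C &
     forall alpha : multiindex d,
       Normc.normc (hermite_coef f alpha) <=
       C * r ^+ mabs alpha * (mfact alpha)%:R `^ (- 2^-1)) <->
  (forall r : R, 0 < r -> exists2 C : R, 0 < C &
     forall N : nat, (2 <= N)%N ->
       (hermite_series_norm (harmonic_pow N f) <=
        (C * 2 ^+ N * r `^ (N%:R / ln N%:R) *
         (2 * N%:R / ln N%:R) `^ (N%:R * (1 - (ln N%:R)^-1)))%:E)%E).
Proof.
split=> [decay r r0|growth s s0].
- have [s s0 [B B0 sB]] := monomial_le_weight R r r0.
  (* Then [s^m = rho^m 2^(d m) 2^m]: one power of 2 pays for passing from [alpha!] to [m!], the
     other yields the summable [2^-n]. *)
  pose rho := s / 2 ^+ d.+1.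
  have rho0 : 0 < rho by rewrite divr_gt0 // exprn_gt0.
  have [C C0 aC] := decay rho rho0.
  pose A := C * rho ^- d.+1 * Num.sqrt d.+1`!%:R.
  have A0 : 0 < A.
    by rewrite !mulr_gt0 ?invr_gt0 ?exprn_gt0 ?sqrtr_gt0 ?ltr0n ?fact_gt0.
  exists (A * B * Num.sqrt (2 ^+ d)).
    by rewrite (mulr_gt0 (mulr_gt0 A0 B0)) // sqrtr_gt0 exprn_gt0.
  move=> N N2; have w0 := weight_gt0 R r N r0 N2.
  rewrite -[X in (_ <= X%:E)%E]mulrA -/(weight r N).
  rewrite (_ : _ * weight r N = A * 2 ^+ N * (B * weight r N) * Num.sqrt (2 ^+ d)); last by ring.
  apply: hermite_series_norm_le => [|alpha].
    by rewrite (mulr_ge0 (mulr_ge0 (ltW A0) _) (mulr_ge0 (ltW B0) (ltW w0))) ?exprn_ge0.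
  (* The shift by [d + 1] gives [2 n + d <= 2 m] and keeps [m] positive even for [n = d = 0]. *)
  rewrite /harmonic_pow normc_natXM; set n := mabs alpha; pose m := (n + d.+1)%N.
  apply: le_trans (ler_wpM2l _ (aC alpha)) _; first exact: exprn_ge0.
  rewrite powRN_half // -/n.
  have kle : (2 * n + d)%:R ^+ N <= 2 ^+ N * m%:R ^+ N :> R.
    rewrite -exprMn lerXn2r ?nnegrE ?mulr_ge0 // -natrM ler_nat /m; lia.
  have nle : 1 <= 2 ^+ m * 2^-1 ^+ n :> R.
    rewrite exprVn ler_pdivlMr ?exprn_gt0 // mul1r ler_weXn2l ?ler1n //; exact: leq_addr.
  have rhoE : rho ^+ n = rho ^- d.+1 * rho ^+ m.
    by rewrite /m addnC exprD mulKf // expf_neq0 // gt_eqF.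
  have sE : s ^+ m = rho ^+ m * 2 ^+ (d * m) * 2 ^+ m.
    by rewrite -mulrA -exprD addnC -mulSn exprM -exprMn /rho divfK.
  have key := sB m N ltac:(rewrite /m; lia) N2.
  apply: (@le_trans _ _ ((2 ^+ N * m%:R ^+ N) *
      (C * (rho ^- d.+1 * rho ^+ m) *
       (Num.sqrt d.+1`!%:R * 2 ^+ (d * m) / Num.sqrt m`!%:R)))).
    rewrite rhoE; apply: ler_pM kle _; rewrite ?exprn_ge0 //.
      by rewrite !mulr_ge0 ?invr_ge0 ?sqrtr_ge0 ?exprn_ge0 // ltW.
    by rewrite ler_wpM2l ?inv_sqrt_mfact_le // !mulr_ge0 ?invr_ge0 ?exprn_ge0 // ltW.
  have bound_ge0 : 0 <= A * 2 ^+ N by rewrite mulr_ge0 ?(ltW A0) ?exprn_ge0.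
  have half_ge0 : 0 <= 2^-1 ^+ n :> R by rewrite exprn_ge0.
  apply: le_trans (ler_wpM2r half_ge0 (ler_wpM2l bound_ge0 key)).
  set X := leLHS; rewrite [leRHS](_ : _ = X * (2 ^+ m * 2^-1 ^+ n)); last first.
    by rewrite /X sE /A; ring.
  rewrite ler_peMr // /X !mulr_ge0 ?invr_ge0 ?sqrtr_ge0 ?exprn_ge0 // ltW //.
(* With [r = u^2], [r^(n/2) = u^n]; [2 u <= s] leaves a factor [2^n] to absorb [n], and [u <= 1]
   gives [r <= 1]. *)
pose u := Num.min 1 (s / 2); have u0 : 0 < u by rewrite lt_min ltr01 divr_gt0.
have us : 2 * u <= s.
  by rewrite -ler_pdivlMl // mulrC ge_min lexx orbT.
have u1 : u <= 1 by rewrite ge_min lexx.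
pose r := u ^+ 2; have r0 : 0 < r by rewrite exprn_gt0.
have r1 : r <= 1 by rewrite exprn_ile1 // ltW.
have [C C0 bC] := growth r r0.
have aC alpha (N : nat) : (2 <= N)%N ->
    (2 * mabs alpha + d)%:R ^+ N * Normc.normc (hermite_coef f alpha) <=
    C * 2 ^+ N * weight r N.
  move=> N2; rewrite -normc_natXM -lee_fin.
  have bN : (hermite_series_norm (harmonic_pow N f) <= (C * 2 ^+ N * weight r N)%:E)%E.
    by rewrite /weight mulrA; exact: bC.
  exact: le_trans (normc_le_hermite_series_norm _ _ (harmonic_pow N f) alpha) bN.
(* [K] bounds all coefficients, through [N = 2] when [alpha] is nonzero. The zero index is kept
   apart because its eigenvalue [d] vanishes for [d = 0]. *)
pose a0 := Normc.normc (hermite_coef f [ffun=> 0%N]).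
pose K := C * 2 ^+ 2 * weight r 2 + a0.
have w20 : 0 < C * 2 ^+ 2 * weight r 2.
  by rewrite mulr_gt0 ?weight_gt0 // mulr_gt0.
have K0 : 0 < K.
  by rewrite ltr_wpDr ?normc_ge0.
have aK alpha : Normc.normc (hermite_coef f alpha) <= K.
  have [n0|n0] := posnP (mabs alpha).
    have -> : alpha = [ffun=> 0%N].
      apply/ffunP => i; rewrite ffunE; apply/eqP; rewrite -leqn0 -n0.
      by rewrite /mabs (bigD1 i) //= leq_addr.
    by rewrite /K ler_wpDl // ltW.
  rewrite /K ler_wpDr ?normc_ge0 //; apply: le_trans (aC alpha 2%N isT).
  rewrite ler_peMl ?normc_ge0 // exprn_ege1 // ler1n; lia.
(* A lower bound for [s^n / sqrt alpha!] when [n < 8], so that [K / k8] settles the small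
   degrees. *)
pose k8 := (u ^+ 8 * (Num.sqrt 8`!%:R)^-1).
have k80 : 0 < k8 by rewrite mulr_gt0 ?exprn_gt0.
exists (K / k8 + C / r); first exact: addr_gt0 (divr_gt0 K0 k80) (divr_gt0 C0 r0).
move=> alpha; set n := mabs alpha; rewrite powRN_half //.
have g0 : 0 < Num.sqrt (mfact alpha)%:R :> R by rewrite sqrtr_gt0 ltr0n mfact_gt0.
have sqle : (Num.sqrt n`!%:R)^-1 <= (Num.sqrt (mfact alpha)%:R)^-1 :> R.
  rewrite lef_pV2 ?posrE // ?sqrtr_gt0 ?ltr0n ?fact_gt0 //.
  by rewrite ler_wsqrtr // ler_nat leq_mfact.
have [n8|n8] := leqP 8 n; last first.
  have kle : k8 <= s ^+ n * (Num.sqrt (mfact alpha)%:R)^-1.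
    apply: ler_pM; rewrite ?exprn_ge0 ?invr_ge0 ?sqrtr_ge0 //; first exact: ltW.
      apply: (@le_trans _ _ (u ^+ n)).
        by rewrite ler_wiXn2l ?(ltW u0) // ltnW.
      by rewrite lerXn2r ?nnegrE ?(ltW u0) ?(ltW s0) //; lra.
    apply: le_trans sqle; rewrite lef_pV2 ?posrE ?sqrtr_gt0 ?ltr0n ?fact_gt0 //.
    by rewrite ler_wsqrtr // ler_nat leq_fact // ltnW.
  rewrite -mulrA mulrDl.
  apply: (@le_trans _ _ K); first exact: aK.
  rewrite ler_wpDr ?mulr_ge0 ?invr_ge0 ?exprn_ge0 ?(ltW s0) ?(ltW C0) ?(ltW u0) ?(ltW g0) //.
  by rewrite mulrAC -mulrA ler_peMr ?(ltW K0) // ler_pdivlMr // mul1r.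
have nR : 0 < n%:R :> R by rewrite ltr0n (leq_trans _ n8).
have [N N4 wN] := exists_weight_le R r n r0 r1 n8.
have h := aC alpha N (leq_trans (isT : 2 <= 4)%N N4).
have p2 : 0 < 2 ^+ N :> R by rewrite exprn_gt0.
move: (weight r N) wN h => w wN h.
(* As [2 n <= 2 n + d], the factor [2^N] of (2) cancels. *)
have h2 : n%:R ^+ N * Normc.normc (hermite_coef f alpha) <= C * w.
  rewrite -(ler_pM2l p2) mulrA -exprMn.
  apply: (@le_trans _ _ (C * 2 ^+ N * w)); last by rewrite mulrCA mulrA.
  apply: le_trans h; rewrite ler_wpM2r ?normc_ge0 // lerXn2r ?nnegrE ?mulr_ge0 //.
  by rewrite -natrM ler_nat leq_addr.
have h3 : Normc.normc (hermite_coef f alpha) <=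
    C / r * (n%:R * expR (n%:R / 2 * (ln r - ln n%:R))).
  rewrite -(ler_pM2l (exprn_gt0 N nR)); apply: le_trans h2 _.
  apply: le_trans (ler_wpM2l (ltW C0) wN) _.
  by rewrite le_eqVlt; apply/orP; left; apply/eqP; ring.
apply: le_trans h3 _; rewrite -[leRHS]mulrA.
apply: (@le_trans _ _ (C / r * (s ^+ n * (Num.sqrt (mfact alpha)%:R)^-1))); last first.
  by rewrite mulrDl lerDr !mulr_ge0 ?invr_ge0 ?exprn_ge0 // ltW.
rewrite (ler_wpM2l (ltW (divr_gt0 C0 r0))) //.
have eE : expR (n%:R / 2 * (ln r - ln n%:R)) = u ^+ n / Num.sqrt (n%:R ^+ n).
  rewrite -[RHS]lnK ?posrE ?divr_gt0 ?exprn_gt0 ?sqrtr_gt0 ?exprn_gt0 //; congr expR.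
  rewrite ln_div ?posrE ?sqrtr_gt0 ?exprn_gt0 // -powR12_sqrt ?exprn_ge0 // ln_powR.
  by rewrite /r !lnXn //; field.
(* Hence [n u^n <= (2 u)^n <= s^n], while [alpha! <= n! <= n^n] handles the denominator. *)
have n2 : n%:R <= 2 ^+ n :> R by rewrite -natrX ler_nat ltnW // ltn_expl.
rewrite eE [leLHS]mulrA; apply: ler_pM;
  rewrite ?invr_ge0 ?sqrtr_ge0 ?mulr_ge0 ?exprn_ge0 ?(ltW u0) //.
  apply: (@le_trans _ _ ((2 * u) ^+ n)).
    by rewrite exprMn ler_wpM2r // exprn_ge0 // ltW.
  by rewrite lerXn2r ?nnegrE ?mulr_ge0 ?(ltW u0) ?(ltW s0).
apply: le_trans sqle.
rewrite lef_pV2 ?posrE ?sqrtr_gt0 ?exprn_gt0 ?ltr0n ?fact_gt0 ?(leq_trans _ n8) //.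
by rewrite ler_wsqrtr // -natrX ler_nat leq_fact_expn.
Qed.
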